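(* Let $f:\mathbb{R}^N\to\mathbb{R}$ be a smooth function whose zero set $M=Z(f)$ is a closed embedded smooth submanifold of $\mathbb{R}^N$, and let $U\subset\mathbb{R}^N$ be a convex set with $M\subset U$. Let $C_1,C_2>0$. If $|\operatorname{Hess} f|_2\le C_1$ on $U$ and $|\nabla f|_1\ge C_2$ on $M$, then the reach $\tau$ of $M$ satisfies $$\tau\ \ge\ \frac{C_2}{2\sqrt{N}\,C_1}.$$
   Context: Closed submanifold means compact without boundary. For a matrix $A$, $|A|_2=\max_{x\neq0}|Ax|_{\mathbb{R}^N}/|x|_{\mathbb{R}^N}$, where $|\cdot|_{\mathbb{R}^N}$ is the Euclidean norm; $|v|_1=\sum_i|v_i|$. For $p\in\mathbb{R}^N$ let $d(p,M)=\inf_{s\in M}|s-p|_{\mathbb{R}^N}$, let $\pi_M(p)=\{x\in M: |p-x|_{\mathbb{R}^N}=d(p,M)\}$, and for $r\ge 0$ let $U_M^r=\{p\in\mathbb{R}^N:d(p,M)<r\}$. The reach of $M$ is $\tau=\sup\{r\ge0: \pi_M(p)\text{ consists of exactly one point for all }p\in U_M^r\}$. *)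

(* Defs.v *)
(* Over an arbitrary R : realType, with R^N rendered as 'rV[R]_N. *)
From mathcomp Require Import all_boot all_order all_algebra.
From mathcomp Require Import all_classical all_reals all_analysis.

Set Implicit Arguments.
Unset Strict Implicit.
Unset Printing Implicit Defensive.

Import Order.TTheory GRing.Theory Num.Theory.
Import numFieldNormedType.Exports.

Local Open Scope classical_set_scope.
Local Open Scope ring_scope.

(* The library norm of 'rV[R]_N is the sup norm: it induces the usual topology
   and the usual derivatives, but not the Euclidean metric needed below. *)
Definition enorm (R : realType) (N : nat) (v : 'rV[R]_N) : R :=
  Num.sqrt (\sum_(i < N) v 0 i ^+ 2).

Definition norm1 (R : realType) (N : nat) (v : 'rV[R]_N) : R :=
  \sum_(i < N) `|v 0 i|.

(* x *m A^T is the row vector representing A x. The supremum is the maximum: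
   the quotients already take all their values on the unit sphere. *)
Definition opnorm2 (R : realType) (N : nat) (A : 'M[R]_N) : R :=
  sup [set enorm (x *m A^T) / enorm x | x in [set x : 'rV[R]_N | x != 0]].

Definition partial (R : realType) (N : nat) (V : normedModType R) (i : 'I_N)
    (g : 'rV[R]_N -> V) : 'rV[R]_N -> V :=
  'D_(delta_mx 0 i) g.

Definition grad (R : realType) (N : nat) (f : 'rV[R]_N -> R) (x : 'rV[R]_N) :
    'rV[R]_N :=
  \row_i partial i (f : 'rV[R]_N -> R^o) x.

Definition Hess (R : realType) (N : nat) (f : 'rV[R]_N -> R) (x : 'rV[R]_N) :
    'M[R]_N :=
  \matrix_(i, j) partial i (partial j (f : 'rV[R]_N -> R^o)) x.

(* C^k on W: all iterated partial derivatives of order at most k exist and are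
   continuous at the points of W. Only used for open W, where they depend only
   on the restriction of g to W. *)
Fixpoint Ck_on (R : realType) (N : nat) (V : normedModType R)
    (W : set 'rV[R]_N) (k : nat) (g : 'rV[R]_N -> V) : Prop :=
  (forall x, W x -> {for x, continuous g}) /\
  if k is k'.+1 then
    forall i : 'I_N,
      (forall x, W x -> derivable g x (delta_mx 0 i)) /\
      Ck_on W k' (partial i g)
  else True.

Definition smooth_on (R : realType) (N : nat) (V : normedModType R)
    (W : set 'rV[R]_N) (g : 'rV[R]_N -> V) : Prop :=
  forall k, Ck_on W k g.

Definition diffeo_on (R : realType) (N : nat) (W W' : set 'rV[R]_N)
    (phi psi : 'rV[R]_N -> 'rV[R]_N) : Prop :=
  [/\ smooth_on W phi /\ smooth_on W' psi,
      (forall x, W x -> W' (phi x)), (forall y, W' y -> W (psi y)),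
      (forall x, W x -> psi (phi x) = x) & (forall y, W' y -> phi (psi y) = y)].

(* Embedded smooth submanifold (without boundary) of dimension k, by slice
   charts: near each of its points, some diffeomorphism of open subsets of R^N
   straightens M to R^k x {0}. *)
Definition embedded_submanifold (R : realType) (N k : nat)
    (M : set 'rV[R]_N) : Prop :=
  (k <= N)%N /\
  forall p, M p -> exists (W W' : set 'rV[R]_N) (phi psi : 'rV[R]_N -> 'rV[R]_N),
    [/\ open W, W p, open W', diffeo_on W W' phi psi &
        forall x, W x ->
          (M x <-> forall i : 'I_N, (k <= i)%N -> phi x 0 i = 0)].

Definition closed_submanifold (R : realType) (N : nat) (M : set 'rV[R]_N) :
    Prop :=
  compact M /\ exists k, embedded_submanifold k M.

(* Extended-real valued, so that the distance to the empty set is +oo. *)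
Definition dist_to (R : realType) (N : nat) (p : 'rV[R]_N) (M : set 'rV[R]_N) :
    \bar R :=
  ereal_inf [set (enorm (s - p))%:E | s in M].

Definition nearest (R : realType) (N : nat) (M : set 'rV[R]_N)
    (p : 'rV[R]_N) : set 'rV[R]_N :=
  [set x | M x /\ (enorm (p - x))%:E = dist_to p M].

Definition tube (R : realType) (N : nat) (M : set 'rV[R]_N) (r : R) :
    set 'rV[R]_N :=
  [set p | (dist_to p M < r%:E)%E].

(* The reach may be +oo, for instance when M is a single point. *)
Definition reach (R : realType) (N : nat) (M : set 'rV[R]_N) : \bar R :=
  ereal_sup [set r%:E | r in
    [set r : R | 0 <= r /\
      forall p, tube M r p -> exists x, nearest M p = [set x]]].

(* Main.v *)
Require Import Defs.
From mathcomp Require Import all_boot all_order all_algebra.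
From mathcomp Require Import all_classical all_reals all_analysis.
From mathcomp Require Import ring lra.

Import Order.TTheory GRing.Theory Num.Theory.
Import numFieldNormedType.Exports.

Local Open Scope classical_set_scope.
Local Open Scope ring_scope.

(** Suppose that [p] lies closer to [M] than the claimed bound and has two
    nearest points [a] and [b], at the common distance [r]; put [h = b - a] and
    [g = grad f a], which is nonzero.

    Since [a] minimises the distance to [p] on the zero set of [f], the vector
    [p - a] is a multiple [k *: g] of the normal there
    ([nearest_point_normal]), so [r = |k| |g|].  Expanding
    [|p - b|^2 = |p - a|^2] gives [|h|^2 = 2 k (g . h)]: the point [b] must
    leave the tangent hyperplane at [a] by an amount quadratic in [|h|].  But
    [f] vanishes at both ends of the segment from [a] to [b], which stays in the
    convex set [U]; by Rolle the derivative of [f] along [h] vanishes somewhere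
    on it, and the Hessian bound then gives [|g . h| <= C1 |h|^2]
    ([grad_dot_secant_le]).  Hence [|h|^2 <= 2 |k| C1 |h|^2], that is
    [|g| <= 2 r C1].  As [C2 <= |g|_1 <= sqrt N |g|], the distance [r] is at
    least the claimed bound, a contradiction.  A nearest point exists because
    [M] is compact ([nearest_nonempty]), so every point of the open tube has
    exactly one.

    The calculus rests on the fact that a function with continuous partial
    derivatives has a first-order expansion ([first_order_approx]), proved by
    moving one coordinate at a time. *)

(** * Euclidean geometry *)

Definition dot {R : realType} {N : nat} (u v : 'rV[R]_N) : R :=
  \sum_(i < N) u 0 i * v 0 i.

Section EuclideanGeometry.
Context {R : realType} {N : nat}.
Implicit Types (u v w : 'rV[R]_N) (k : R).

Lemma dotC u v : dot u v = dot v u.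
Proof. by apply: eq_bigr => i _; rewrite mulrC. Qed.

Lemma dotDl u v w : dot (u + v) w = dot u w + dot v w.
Proof. by rewrite -big_split; apply: eq_bigr => i _; rewrite mxE mulrDl. Qed.

Lemma dotZl k u v : dot (k *: u) v = k * dot u v.
Proof. by rewrite mulr_sumr; apply: eq_bigr => i _; rewrite mxE mulrA. Qed.

Lemma dotBl u v w : dot (u - v) w = dot u w - dot v w.
Proof. by rewrite dotDl -scaleN1r dotZl mulN1r. Qed.

Lemma dotDr u v w : dot u (v + w) = dot u v + dot u w.
Proof. by rewrite dotC dotDl !(dotC u). Qed.

Lemma dotZr k u v : dot u (k *: v) = k * dot u v.
Proof. by rewrite dotC dotZl dotC. Qed.

Lemma dotBr u v w : dot u (v - w) = dot u v - dot u w.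
Proof. by rewrite dotC dotBl !(dotC u). Qed.

Lemma enorm_ge0 u : 0 <= enorm u.
Proof. exact: sqrtr_ge0. Qed.

Lemma dot_ge0 u : 0 <= dot u u.
Proof. by apply: sumr_ge0 => i _; rewrite -expr2 sqr_ge0. Qed.

Lemma sqr_enorm u : enorm u ^+ 2 = dot u u.
Proof.
rewrite sqr_sqrtr; last by apply: sumr_ge0 => i _; exact: sqr_ge0.
by apply: eq_bigr => i _; rewrite expr2.
Qed.

Lemma enormE u : enorm u = Num.sqrt (dot u u).
Proof. by rewrite -sqr_enorm sqrtr_sqr ger0_norm // enorm_ge0. Qed.

Lemma dot_eq0 u : (dot u u == 0) = (u == 0).
Proof.
apply/eqP/eqP => [|->]; last by rewrite /dot big1 // => i _; rewrite mxE mul0r.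
move=> /eqP; rewrite psumr_eq0 => [/allP u0|i _]; last by rewrite -expr2 sqr_ge0.
apply/rowP => i; have := u0 i; rewrite mem_index_enum mxE => /(_ isT)/=.
by rewrite mulf_eq0 orbb => /eqP.
Qed.

Lemma dot_gt0 u : u != 0 -> 0 < dot u u.
Proof. by rewrite -dot_eq0 lt0r dot_ge0 andbT. Qed.

Lemma enorm_gt0 u : u != 0 -> 0 < enorm u.
Proof. by move=> /dot_gt0; rewrite enormE sqrtr_gt0. Qed.

Lemma enormN u : enorm (- u) = enorm u.
Proof. by congr Num.sqrt; apply: eq_bigr => i _; rewrite mxE sqrrN. Qed.

Lemma enormBC u v : enorm (u - v) = enorm (v - u).
Proof. by rewrite -enormN opprB. Qed.

Lemma enormZ k u : enorm (k *: u) = `|k| * enorm u.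
Proof.
by rewrite !enormE dotZl dotZr mulrA -expr2 sqrtrM ?sqr_ge0 // sqrtr_sqr.
Qed.

Lemma cauchy_schwarz u v : `|dot u v| <= enorm u * enorm v.
Proof.
have [->|v0] := eqVneq v 0.
  by rewrite -[0](scale0r 0) dotZr mul0r normr0 mulr_ge0 ?enorm_ge0.
rewrite -ler_sqr ?nnegrE ?mulr_ge0 ?enorm_ge0 // real_normK ?num_real //.
rewrite exprMn !sqr_enorm.
have v2 := dot_gt0 v v0.
(* [v.v] times the component of [u] orthogonal to [v], cleared of division. *)
have := dot_ge0 (dot v v *: u - dot u v *: v).
rewrite !(dotBl, dotBr, dotZl, dotZr) (dotC v u) => H.
have {}H : 0 <= dot v v * (dot u u * dot v v - dot u v ^+ 2).
  by rewrite (le_trans H) // le_eqVlt; apply/orP; left; apply/eqP; ring.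
by rewrite pmulr_rge0 // subr_ge0 in H.
Qed.

(** Cauchy-Schwarz against the vector of signs, whose norm is at most
    [sqrt N]. *)
Lemma norm1_le_enorm u : norm1 u <= Num.sqrt N%:R * enorm u.
Proof.
pose s : 'rV[R]_N := \row_i Num.sg (u 0 i).
have -> : norm1 u = dot s u.
  by apply: eq_bigr => i _; rewrite mxE normrEsg.
apply: le_trans (ler_norm _) _; apply: le_trans (cauchy_schwarz _ _) _.
apply: ler_wpM2r; first exact: enorm_ge0.
rewrite ler_wsqrtr //.
have -> : N%:R = \sum_(i < N) (1 : R).
  by rewrite sumr_const card_ord.
apply: ler_sum => i _.
by rewrite mxE sqr_sg; case: (_ != _).
Qed.

Lemma norm1_ge0 u : 0 <= norm1 u.
Proof. exact: sumr_ge0. Qed.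

Lemma norm1D u v : norm1 (u + v) <= norm1 u + norm1 v.
Proof.
by rewrite -big_split; apply: ler_sum => i _; rewrite mxE ler_normD.
Qed.

Lemma norm1Z k u : norm1 (k *: u) = `|k| * norm1 u.
Proof. by rewrite mulr_sumr; apply: eq_bigr => i _; rewrite mxE normrM. Qed.

(** The supremum defining [opnorm2] is over a bounded set, so that it is an
    upper bound: the Frobenius norm of [A] bounds every quotient. *)
Lemma enorm_mulmx_le_opnorm2 (A : 'M[R]_N) u :
  enorm (u *m A^T) <= opnorm2 A * enorm u.
Proof.
have [->|u0] := eqVneq u 0.
  by rewrite mul0mx -[0](scale0r 0) !enormZ normr0 !mul0r mulr0.
rewrite -ler_pdivrMr ?enorm_gt0 //; apply: ub_le_sup; last by exists u.
exists (Num.sqrt (\sum_(i < N) enorm (row i A) ^+ 2)) => _ [x /= x0 <-].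
rewrite ler_pdivrMr ?enorm_gt0 //.
rewrite -[enorm x]ger0_norm ?enorm_ge0 // -sqrtr_sqr -sqrtrM; last first.
  by apply: sumr_ge0 => i _; exact: sqr_ge0.
rewrite ler_wsqrtr // mulr_suml; apply: ler_sum => i _.
rewrite -[leLHS]real_normK ?num_real // -exprMn lerXn2r ?nnegrE //.
  by rewrite mulr_ge0 ?enorm_ge0.
suff -> : (x *m A^T) 0 i = dot (row i A) x by exact: cauchy_schwarz.
by rewrite mxE; apply: eq_bigr => j _; rewrite !mxE mulrC.
Qed.

End EuclideanGeometry.

(** * Functions with continuous partial derivatives *)

Section Calculus.
Context {R : realType}.

Lemma is_derive_line {V : normedModType R} (g : V -> R^o) (x v : V) (t l : R) :
  is_derive (x + t *: v) v g l ->
  is_derive t 1 (fun s : R => g (x + s *: v) : R^o) l.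
Proof.
move=> [dg <-].
have E : (fun h : R => h^-1 *: (g (x + (h *: 1%R + t) *: v) - g (x + t *: v)))
       = (fun h : R => h^-1 *: (g (h *: v + (x + t *: v)) - g (x + t *: v))).
  apply/funext => h.
  by rewrite [h *: 1]mulr1 scalerDl addrCA.
split; first by rewrite /derivable E.
by rewrite /derive E.
Qed.

(** Mean value theorem along a line.  The signed length [a] is arbitrary: the
    theorem is applied on the unit interval after rescaling the parameter by [a]. *)
Lemma mvt_line {V : normedModType R} (g dg : V -> R^o) (x v : V) (a : R) :
  (forall y, is_derive y v g (dg y)) ->
  exists2 c : R, 0 <= c <= 1 & g (x + a *: v) - g x = a * dg (x + (c * a) *: v).
Proof.
move=> gv; pose phi (s : R) : R^o := g (x + s *: v).
have dphi (s : R) : is_derive s 1 (phi \o ( *%R^~ a)) (dg (x + (s * a) *: v) * a).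
  apply: is_derive1_comp.
    by apply: is_derive_line; exact: gv.
  have -> : ( *%R^~ a) = (a \*: (id : R^o -> R^o)).
    by apply/funext => u /=; rewrite mulrC.
  by apply: is_derive_eq; rewrite [LHS]mulr1.
have [|c c01] := MVT_segment ler01 (fun s _ => dphi s).
  apply: continuous_subspaceT => s.
  by apply: differentiable_continuous; apply/derivable1_diffP; case: (dphi s).
rewrite /phi /= mul1r mul0r scale0r addr0 subr0 mulr1 mulrC => ->.
by exists c.
Qed.

Definition continuous_partials {N : nat} (g : 'rV[R]_N -> R^o) : Prop :=
  forall i : 'I_N, (forall x, derivable g x (delta_mx 0 i)) /\
    continuous (partial i g).

Lemma norm_le_norm1 {N : nat} (u : 'rV[R]_N) : `|u| <= norm1 u.
Proof.
rewrite [leLHS]/Num.Def.normr/= mx_normrE; apply: bigmax_le => [|[i j] _ /=].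
  exact: norm1_ge0.
rewrite ord1 /norm1 (bigD1 j) //= lerDl; exact: sumr_ge0.
Qed.

(** The increment over [h] is the sum of the increments over the coordinate
    steps [h 0 i *: delta_mx 0 i]; each of them is a value of [partial i g]
    nearby, times [h 0 i].  Both the radius and the error are measured in
    [norm1], because it is additive over these steps. *)
Lemma first_order_approx {N : nat} (g : 'rV[R]_N -> R^o) x :
  continuous_partials g -> forall e, 0 < e ->
  exists2 d, 0 < d & forall h, norm1 h < d ->
    `|g (x + h) - g x - dot (grad g x) h| <= e * norm1 h.
Proof.
move=> Cg e e0.
have : \forall y \near x, forall i : 'I_N, `|partial i g x - partial i g y| < e.
  apply: (@filter_forall _ _
    (fun (i : 'I_N) y => `|partial i g x - partial i g y| < e)
    (nbhs x) (nbhs_filter x)).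
  move=> i; have [_ /(_ x)] := Cg i.
  by move=> /cvgrPdist_lt /(_ e e0).
move=> /nbhs_ballP [d /= d0 near_x]; exists d => // h.
(* Induction on the list of coordinates already moved. *)
suff H (s : seq 'I_N) : \sum_(i <- s) `|h 0 i| < d ->
    `|g (x + \sum_(i <- s) h 0 i *: delta_mx 0 i) - g x
      - \sum_(i <- s) grad g x 0 i * h 0 i| <= e * \sum_(i <- s) `|h 0 i|.
  by move=> /H; rewrite -row_sum_delta.
elim: s => [|i s IH]; first by rewrite !big_nil addr0 !subrr normr0 mulr0.
rewrite !big_cons; set u := \sum_(j <- s) _ *: _; set S := \sum_(j <- s) _ * _.
set T := \sum_(j <- s) _ => hd.
have {}IH : `|g (x + u) - g x - S| <= e * T.
  by apply: IH; apply: le_lt_trans hd; rewrite lerDr.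
have [c /andP[c0 c1]] := mvt_line g (partial i g) (x + u) (delta_mx 0 i) (h 0 i)
  (fun y => derivableP (proj1 (Cg i) y)).
rewrite -addrA (addrC u) => E.
set y := x + u + _ in E.
have u_le : norm1 u <= T.
  rewrite /u /T; elim: (s) => [|j r IHr]; rewrite ?big_nil ?big_cons.
    by rewrite /norm1 big1 // => j _; rewrite mxE normr0.
  apply: le_trans (norm1D _ _) _; apply: lerD => //.
  rewrite norm1Z /norm1 (bigD1 j) //= big1 => [|k kj]; rewrite mxE eqxx /= ?eqxx.
    by rewrite normr1 addr0 mulr1.
  by rewrite (negbTE kj) normr0.
have yx : `|partial i g x - partial i g y| < e.
  apply: near_x; rewrite -ball_normE /=.
  rewrite /y -!addrA opprD addNKr normrN.
  apply: le_lt_trans (norm_le_norm1 _) _.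
  apply: le_lt_trans (norm1D _ _) _; apply: le_lt_trans hd.
  rewrite [leRHS]addrC; apply: lerD => //.
  rewrite norm1Z normrM (ger0_norm c0) /norm1 (bigD1 i) //=.
  rewrite big1 => [|k kj]; rewrite mxE eqxx /= ?eqxx ?(negbTE kj) ?normr0 //.
  by rewrite normr1 addr0 mulr1 ler_piMl.
have -> : g (x + (h 0 i *: delta_mx 0 i + u)) - g x - (grad g x 0 i * h 0 i + S)
   = (g (x + u) - g x - S) - h 0 i * (partial i g x - partial i g y).
  have -> : g (x + (h 0 i *: delta_mx 0 i + u)) = g (x + u) + h 0 i * partial i g y.
    by rewrite -E; ring.
  by rewrite mxE; ring.
apply: le_trans (ler_normB _ _) _.
rewrite [leRHS]mulrDr [leRHS]addrC; apply: lerD => //.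
by rewrite normrM mulrC ler_wpM2r // ltW.
Qed.

Lemma is_derive_grad {N : nat} (g : 'rV[R]_N -> R^o) x h :
  continuous_partials g -> is_derive x h g (dot (grad g x) h).
Proof.
move=> Cg.
have : (fun t : R => t^-1 *: (g (t *: h + x) - g x)) @ 0^' -->
    (dot (grad g x) h : R^o).
  apply/cvgrPdist_le => e e0.
  have n0 : 0 < norm1 h + 1 by rewrite ltr_wpDl ?norm1_ge0.
  have [d d0 H] := first_order_approx g x Cg _ (divr_gt0 e0 n0).
  near=> t.
  have t0 : t != 0 by near: t; exact: nbhs_dnbhs_neq.
  have td : `|t| < d / (norm1 h + 1).
    near: t; apply: dnbhs0_lt; exact: divr_gt0.
  have := H (t *: h); rewrite norm1Z dotZr.
  have : `|t| * norm1 h < d.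
    rewrite ltr_pdivlMr // in td; apply: le_lt_trans td.
    by rewrite ler_wpM2l // lerDl.
  move=> -> /(_ isT) {}H.
  rewrite distrC (addrC (t *: h)).
  have -> : t^-1 *: (g (x + t *: h) - g x) - dot (grad g x) h
     = t^-1 * (g (x + t *: h) - g x - t * dot (grad g x) h) :> R.
    by rewrite mulrBr mulKf.
  rewrite normrM normfV ler_pdivrMl ?normr_gt0 //.
  apply: le_trans H _; rewrite mulrCA ler_wpM2l // mulrAC ler_pdivrMr //.
  by rewrite ler_wpM2l ?(ltW e0) // lerDl.
move=> L; split; first by apply/cvg_ex; eexists; exact: L.
by apply/cvg_lim; first exact: Rhausdorff.
Unshelve. all: by end_near.
Qed.

End Calculus.

(** * Second-order bound on a secant *)

Section Geometry.
Context {R : realType} {N : nat}.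
Implicit Types (f : 'rV[R]_N -> R^o) (M : set 'rV[R]_N).

Lemma Ck_on_continuous_partials f k :
  Ck_on setT k.+1 f -> continuous_partials f.
Proof.
move=> [_ fC] i; have [df pC] := fC i.
split=> x; first exact: df.
by case: k pC {fC} => [|k] [] /(_ x I).
Qed.

Lemma convex_set_segment (U : set (convex_lmodType 'rV[R]_N)) a b (t : R) :
  convex_set U -> U a -> U b -> 0 <= t <= 1 -> U (a + t *: (b - a)).
Proof.
move=> cU Ua Ub /andP[t0 t1].
have := cU b a (Itv01 t0 t1); rewrite !inE => /(_ Ub Ua).
have -> // : a + t *: (b - a) = t *: b + (1 - t) *: a.
by rewrite scalerBl scale1r scalerBr addrCA.
Qed.

(** By Rolle the derivative along [b - a] vanishes at some point of the segment,
    and it varies by at most [C * |b - a|^2] between [a] and that point. *)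
Lemma grad_dot_secant_le f (U : set (convex_lmodType 'rV[R]_N)) C a b :
  Ck_on setT 2 f -> convex_set U -> U a -> U b ->
  (forall x, U x -> opnorm2 (Hess f x) <= C) -> f a = f b ->
  `|dot (grad f a) (b - a)| <= C * enorm (b - a) ^+ 2.
Proof.
move=> f2 cU Ua Ub HC fab; set h := b - a.
have pf2 j : continuous_partials (partial j f).
  by apply: (@Ck_on_continuous_partials _ 0); case: f2 => _ /(_ j)[].
have Cf := Ck_on_continuous_partials _ _ f2.
have [c c01] := mvt_line f _ a h 1 (fun y => is_derive_grad f y h Cf).
rewrite scale1r subrKC -fab subrr mul1r mulr1 => /esym crit.
(* The derivative of [grad f . h] along [h] is the Hessian form at [h]. *)
pose dG y := dot h (h *m (Hess f y)^T).
have G y : is_derive y h (fun y => dot (grad f y) h : R^o) (dG y).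
  have -> : (fun y => dot (grad f y) h : R^o) =
      \sum_(j < N) (h 0 j \*: partial j f).
    apply/funext => z; rewrite fct_sumE; apply: eq_bigr => j _ /=.
    by rewrite mxE mulrC.
  have dp j := is_derive_grad (partial j f) y h (pf2 j).
  apply: is_derive_eq.
  rewrite /dG /dot /=.
  transitivity (\sum_(j < N) \sum_(i < N) h 0 j * (Hess f y i j * h 0 i)).
    apply: eq_bigr => j _; rewrite /GRing.scale /= mulr_sumr.
    apply: eq_bigr => i _.
    by rewrite !mxE.
  rewrite exchange_big; apply: eq_bigr => i _.
  rewrite [(_ *m _) _ _]mxE mulr_sumr; apply: eq_bigr => j _.
  by rewrite [_^T _ _]mxE; ring.
have [c' c'01] := mvt_line _ dG a h c G.
rewrite crit sub0r => E.
have cc01 : 0 <= c' * c <= 1.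
  move: c01 c'01 => /andP[? ?] /andP[? ?]; rewrite mulr_ge0 //=.
  exact: mulr_ile1.
rewrite -normrN E normrM -[leRHS]mul1r.
move: c01 => /andP[c0 c1].
rewrite (ger0_norm c0); apply: ler_pM => //.
apply: le_trans (cauchy_schwarz _ _) _.
rewrite expr2 mulrCA; apply: ler_wpM2l; first exact: enorm_ge0.
apply: le_trans (enorm_mulmx_le_opnorm2 _ _) _.
apply: ler_wpM2r; first exact: enorm_ge0.
by apply: HC; exact: convex_set_segment cU Ua Ub cc01.
Qed.

(** * Nearest points on a zero set *)

(** The Lagrange multiplier rule.  Were the component [w] of [p - a] orthogonal
    to the gradient [g] nonzero, one could move from [a] by [t *: w] and correct
    by some [s *: g] with [|s| <= eta * t] to return to the zero set: [f]
    changes sign over this range of [s] because its slope along [g] is positive,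
    while the step along [w] changes [f] only by o(t).  For small [eta] and [t]
    the new point is closer to [p]. *)
Lemma nearest_point_normal f a p :
  continuous f -> continuous_partials f -> f a = 0 -> grad f a != 0 ->
  (forall x, f x = 0 -> enorm (p - a) <= enorm (p - x)) ->
  exists k, p - a = k *: grad f a.
Proof.
move=> f_cont Cf fa0 g0 amin; set g := grad f a in g0 *; set q := p - a in amin *.
pose G := dot g g; have G0 : 0 < G := dot_gt0 g g0.
exists (dot q g / G); apply/eqP; rewrite -subr_eq0; apply/negPn/negP.
set w := q - _ => w0.
pose W := dot w w; have W0 : 0 < W := dot_gt0 w w0.
have wg : dot w g = 0 by rewrite /w dotBl dotZl divfK ?subrr // gt_eqF.
have wq : dot w q = W.
  by rewrite -[X in dot w X](subrK (dot q g / G *: g)) -/w dotDr dotZr wg mulr0 addr0.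
pose K := dot g q.
have K1 : 0 < `|K| + 1 by rewrite ltr_wpDl.
(* [eta] is chosen so that the correction loses at most a quarter of the
   first-order gain [2 * t * W] in the squared distance. *)
pose eta := W / (4 * (`|K| + 1)).
have eta0 : 0 < eta by rewrite divr_gt0 // mulr_gt0.
have etaK : 2 * eta * `|K| <= W / 2.
  have : eta * (`|K| + 1) = W / 4 by rewrite /eta; field; rewrite gt_eqF.
  by rewrite mulrDr mulr1; lra.
(* [t * n] exceeds the [norm1] of every displacement under consideration. *)
pose n := norm1 w + eta * norm1 g + 1.
have n0 : 0 < n by rewrite ltr_wpDl // addr_ge0 ?mulr_ge0 ?norm1_ge0 // ltW.
have [d d0 approx] := first_order_approx f a Cf (eta * G / n)
  (divr_gt0 (mulr_gt0 eta0 G0) n0).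
(* [t ^+ 2 * B] bounds the squared length of the displacement; [t <= W / B]
   makes it at most half of the first-order gain. *)
pose B := W + eta ^+ 2 * G.
have B0 : 0 < B by rewrite addr_gt0 // mulr_gt0 // exprn_gt0.
pose t := Num.min (d / n) (W / B).
have t0 : 0 < t by rewrite lt_min !divr_gt0.
have tn : t * n <= d by rewrite -ler_pdivlMr // ge_min lexx.
have tB : t * B <= W by rewrite -ler_pdivlMr // ge_min lexx orbT.
have fapp s : `|s| <= eta * t ->
    `|f (a + t *: w + s *: g) - s * G| < eta * t * G.
  move=> st.
  have nb : norm1 (t *: w + s *: g) < t * n.
    apply: le_lt_trans (norm1D _ _) _; rewrite !norm1Z (gtr0_norm t0).
    rewrite /n !mulrDr mulr1 -[ltLHS]addr0; apply: ler_ltD => //.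
    by rewrite lerD2l mulrA (mulrC t) ler_wpM2r ?norm1_ge0.
  have := approx _ (lt_le_trans nb tn).
  rewrite fa0 subr0 dotDr !dotZr -/g (dotC g w) wg mulr0 add0r addrA => H.
  apply: le_lt_trans H _.
  rewrite mulrAC ltr_pdivrMr //.
  rewrite (_ : eta * t * G * n = eta * G * (t * n)); last by ring.
  by rewrite ltr_pM2l // mulr_gt0.
have [|||s] := @IVT R (fun s => f (a + t *: w + s *: g)) (- (eta * t)) (eta * t) 0.
- have et0 : 0 < eta * t by rewrite mulr_gt0.
  by lra.
- apply: continuous_subspaceT => s.
  apply/differentiable_continuous/derivable1_diffP.
  have := is_derive_grad f (a + t *: w + s *: g) g Cf.
  by move=> /is_derive_line[].
- have et0 : 0 <= eta * t by rewrite mulr_ge0 // ltW.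
  have := fapp (eta * t); have := fapp (- (eta * t)).
  rewrite normrN (ger0_norm et0) lexx => /(_ isT) fm /(_ isT) fp.
  move: fm fp; rewrite !ltr_norml => /andP[_ fm] /andP[fp _].
  by rewrite ge_min le_max; apply/andP; split; apply/orP; [left|right]; lra.
rewrite in_itv /= -ler_norml => st fs0.
have := amin _ fs0; apply/negP; rewrite -ltNge.
rewrite -ltr_sqr ?nnegrE ?enorm_ge0 // !sqr_enorm.
have -> : p - (a + t *: w + s *: g) = q - (t *: w + s *: g).
  by rewrite -addrA opprD addrA.
clearbody w q.
rewrite !(dotBl, dotBr, dotDl, dotDr, dotZl, dotZr) (dotC q w) (dotC q g).
rewrite (dotC g w) wg wq -/W -/G -/K.
have s2G : s ^+ 2 * G <= (eta * t) ^+ 2 * G.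
  apply: ler_wpM2r; first exact: ltW.
  have et0 : 0 <= eta * t by rewrite mulr_ge0 // ltW.
  by rewrite -(real_normK (num_real s)) lerXn2r ?nnegrE.
have sK : - (s * K) <= t * (eta * `|K|).
  apply: le_trans (ler_norm _) _; rewrite normrN normrM mulrA (mulrC t).
  by rewrite ler_wpM2r.
have tetaK : t * (2 * eta * `|K|) <= t * (W / 2) by rewrite ler_wpM2l // ltW.
have ttB : t * (t * B) <= t * W by rewrite ler_wpM2l // ltW.
have tW : 0 < t * W by rewrite mulr_gt0.
rewrite /B in ttB; lra.
Qed.

Lemma enorm_continuous : continuous (@enorm R N).
Proof.
move=> x; apply: continuous_comp; last exact: sqrt_continuous.
move: x; apply: (@continuous_big R^o _ +%R 0 xpredT (@add_continuous R^o) _ _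
  (fun i (v : 'rV[R]_N) => v 0 i ^+ 2)) => i _ x.
apply: (continuous_comp (f := fun v : 'rV[R]_N => v 0 i) (g := fun y => y ^+ 2)).
  exact: coord_continuous.
exact: exprn_continuous.
Qed.

Lemma nearest_nonempty M p : compact M -> M !=set0 -> nearest M p !=set0.
Proof.
move=> cM M0.
have [|a /set_mem Ma amin] := @EVT_min_rV R N (fun x => enorm (p - x)) M M0 cM.
  apply: continuous_subspaceT => x.
  apply: continuous_comp; last exact: enorm_continuous.
  by apply: continuousB => //; exact: cst_continuous.
exists a; split => //; apply/esym/eqP; rewrite eq_le; apply/andP; split.
  by apply: ereal_inf_lbound; exists a => //; rewrite enormBC.
apply: le_ereal_inf_tmp => _ [x Mx <-].
by rewrite lee_fin (enormBC x); apply: amin; exact: mem_set.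
Qed.

Lemma nearest_le M p a x : nearest M p a -> M x -> enorm (p - a) <= enorm (p - x).
Proof.
move=> [_ E] Mx; rewrite -lee_fin E; apply: ereal_inf_lbound.
by exists x => //; rewrite enormBC.
Qed.

End Geometry.

(** * The bound on the reach *)

Theorem corollary4p8 (R : realType) (N : nat) (f : 'rV[R]_N -> R)
    (M U : set 'rV[R]_N) (C1 C2 : R)
    (f_smooth : smooth_on setT (f : 'rV[R]_N -> R^o))
    (M_zero : M = [set x | f x = 0])
    (M_closed : closed_submanifold M)
    (U_convex : convex_set (U : set (convex_lmodType 'rV[R]_N)))
    (M_sub_U : M `<=` U)
    (C1_gt0 : 0 < C1) (C2_gt0 : 0 < C2)
    (Hess_le : forall x, U x -> opnorm2 (Hess f x) <= C1)
    (grad_ge : forall x, M x -> C2 <= norm1 (grad f x)) :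
  ((C2 / (2 * Num.sqrt N%:R * C1))%:E <= reach M)%E.
Proof.
set r0 := C2 / _.
have sN : 0 <= Num.sqrt (N%:R : R) by exact: sqrtr_ge0.
apply: ereal_sup_ubound; exists r0 => //=; split.
  by rewrite divr_ge0 ?mulr_ge0 // ltW.
move=> p pr0.
have M0 : M !=set0.
  apply/set0P/eqP => M0; move: pr0; rewrite /tube /= /dist_to M0 image_set0.
  by rewrite ereal_inf0.
have [a aN] := nearest_nonempty M p (proj1 M_closed) M0.
have [Ma aD] := aN.
exists a; rewrite eqEsubset; split => [b bN|_ -> //].
have [Mb bD] := bN.
apply/eqP; rewrite -subr_eq0; apply/negPn/negP => ba.
have fM x : M x -> f x = 0 by rewrite M_zero.
have g0 : grad f a != 0.
  apply/eqP => g0; have := grad_ge a Ma.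
  by rewrite g0 /norm1 big1 => [|i _]; rewrite ?mxE ?normr0 // leNgt C2_gt0.
have f2 := f_smooth 2%N.
have Cf := Ck_on_continuous_partials f 1 f2.
have [|x fx|k pa] := nearest_point_normal f a p _ Cf (fM a Ma) g0.
- by move=> x; case: f2 => /(_ x I).
- by apply: nearest_le aN _; rewrite M_zero.
have r_lt : enorm (p - a) < r0.
  by move: pr0; rewrite /tube /= -aD lte_fin.
have eqr : enorm (p - b) = enorm (p - a).
  by apply: EFin_inj; rewrite aD bD.
pose h := b - a.
have h2 : enorm h ^+ 2 = 2 * k * dot (grad f a) h.
  have : dot (p - b) (p - b) = dot (p - a) (p - a) by rewrite -!sqr_enorm eqr.
  have -> : p - b = p - a - h by rewrite /h opprB addrA subrK.
  rewrite !(dotBl (p - a) h, dotBr _ (p - a) h) (dotC h (p - a)) => E.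
  rewrite sqr_enorm -mulrA -dotZl -pa.
  by move: E; lra.
have taylor : `|dot (grad f a) h| <= C1 * enorm h ^+ 2.
  by apply: (grad_dot_secant_le f U) => //; rewrite ?fM //; exact: M_sub_U.
have h0 : 0 < enorm h ^+ 2 by rewrite exprn_gt0 // enorm_gt0.
have k_ge : 1 <= 2 * `|k| * C1.
  rewrite -(ler_pM2r h0) mul1r {1}h2.
  apply: le_trans (ler_norm _) _.
  rewrite normrM normrM normr_nat -[leRHS]mulrA.
  by apply: ler_wpM2l => //; rewrite mulr_ge0.
have g_le : enorm (grad f a) <= 2 * enorm (p - a) * C1.
  rewrite pa enormZ -[leLHS]mul1r.
  rewrite (_ : 2 * _ * C1 = 2 * `|k| * C1 * enorm (grad f a)); last by ring.
  by rewrite ler_wpM2r ?enorm_ge0.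
have C2_le : C2 <= 2 * Num.sqrt N%:R * C1 * enorm (p - a).
  apply: le_trans (grad_ge a Ma) _; apply: le_trans (norm1_le_enorm _) _.
  apply: le_trans (ler_wpM2l sN g_le) _.
  by rewrite le_eqVlt; apply/orP; left; apply/eqP; ring.
have D0 : 0 < 2 * Num.sqrt N%:R * C1.
  rewrite !mulr_gt0 // lt0r sN andbT; apply/eqP => sN0.
  by move: C2_le; rewrite sN0 mulr0 !mul0r leNgt C2_gt0.
by move: r_lt; rewrite ltr_pdivlMr // mulrC ltNge C2_le.
Qed.
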